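(* Let $K$ be a finite simplicial complex, let $N\subseteq K$ be closed, and let $\mathcal{V}_1,\mathcal{V}_2$ be multivector fields on $K$. For $i=1,2$ let $(P_i,E_i)$ be an index pair in $N$ under $\mathcal{V}_i$ (for some invariant set $S_i$ isolated by $N$ under $\mathcal{V}_i$). Then $(P_1\cap P_2,\,E_1\cap E_2)$ is an index pair in $N$ under $\mathcal{V}_1\overline{\cap}\mathcal{V}_2$ for the set $\mathrm{Inv}_{\mathcal{V}_1\overline{\cap}\mathcal{V}_2}\big((P_1\cap P_2)\setminus(E_1\cap E_2)\big)$.
   Context: $K$ is identified with its finite set of simplices; $\sigma\le\sigma'$ means that $\sigma$ is a (not necessarily proper) face of $\sigma'$. For $A\subseteq K$, $\mathrm{cl}(A)=\{\tau\in K : \tau\le\sigma \text{ for some }\sigma\in A\}$, $\mathrm{cl}(\sigma)=\mathrm{cl}(\{\sigma\})$, $A$ is closed if $\mathrm{cl}(A)=A$, and $\mathrm{mo}(A)=\mathrm{cl}(A)\setminus A$. A multivector is a set $A\subseteq K$ such that $\sigma\le\tau\le\sigma'$ with $\sigma,\sigma'\in A$, $\tau\in K$ implies $\tau\in A$. A multivector field $\mathcal{V}$ on $K$ is a partition of $K$ into multivectors; $[\sigma]_{\mathcal{V}}$ is the element of $\mathcal{V}$ containing $\sigma$. A multivector $V$ is critical if the relative simplicial homology $H_p(\mathrm{cl}(V),\mathrm{mo}(V))\neq 0$ for some $p$, and regular otherwise. $F_{\mathcal{V}}(\sigma)=\mathrm{cl}(\sigma)\cup[\sigma]_{\mathcal{V}}$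 and $F_{\mathcal{V}}(A)=\bigcup_{\sigma\in A}F_{\mathcal{V}}(\sigma)$. A path (under $\mathcal{V}$) is a map $\rho:\mathbb{Z}\cap[a,b]\to K$ with $\rho(i)\in F_{\mathcal{V}}(\rho(i-1))$ for all integers $a<i\le b$. A solution is a map $\rho:\mathbb{Z}\to K$ with $\rho(i)\in F_{\mathcal{V}}(\rho(i-1))$ for all $i$. It is essential if for each $i$ with $[\rho(i)]_{\mathcal{V}}$ regular there are $i^-<i<i^+$ with $[\rho(i^-)]_{\mathcal{V}}\ne[\rho(i)]_{\mathcal{V}}\ne[\rho(i^+)]_{\mathcal{V}}$. $\mathrm{Inv}_{\mathcal{V}}(A)$ is the set of $\sigma\in A$ for which there is an essential solution $\rho$ with $\rho(\mathbb{Z})\subseteq A$ and $\rho(0)=\sigma$. $A$ is invariant if $\mathrm{Inv}_{\mathcal{V}}(A)=A$. An invariant set $S\subseteq N$, $N$ closed, is isolated by $N$ if every path with values in $N$ and both endpoints in $S$ has all its values in $S$. Index pair in $N$: for an invariant set $S$ isolated by $N$ under $\mathcal{V}$, a pair of closed sets $E\subseteq P\subseteq N$ is an index pair for $S$ in $N$ under $\mathcal{V}$ if (1) $F_{\mathcal{V}}(P)\cap N\subseteq P$; (2) $F_{\mathcal{V}}(E)\cap N\subseteq E$; (3) $F_{\mathcal{V}}(P\setminus E)\subseteq N$; (4) $S=\mathrm{Inv}_{\mathcal{V}}(P\setminus E)$. For multivector fields $\mathcal{V}_1,\mathcal{V}_2$ on $K$, $\mathcal{V}_1\overline{\cap}\mathcal{V}_2$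 is the multivector field consisting of the nonempty sets of the form $V_1\cap V_2$ with $V_1\in\mathcal{V}_1$, $V_2\in\mathcal{V}_2$. *)

(* Defs.v *)
From HB Require Import structures.
From mathcomp Require Import all_boot all_order all_algebra.
From mathcomp Require Import ring_quotient.
From mathcomp Require Import boolp.

Set Implicit Arguments.
Unset Strict Implicit.
Unset Printing Implicit Defensive.

Import Order.TTheory GRing.Theory Num.Theory.

(* A complex is identified with its set of simplices; its vertices lie in the *)
(* finite type T, whose elements need not all be vertices of the complex.     *)
Definition simplicial_complex (T : finType) (K : {set {set T}}) : Prop :=
  set0 \notin K /\
  forall s t : {set T}, s \in K -> t \subset s -> t != set0 -> t \in K.

Section Closure.
Variables (T : finType) (K : {set {set T}}).

Definition cl (A : {set {set T}}) : {set {set T}} :=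
  [set t in K | [exists s in A, t \subset s]].

Definition closed_in (A : {set {set T}}) : Prop := cl A = A.

Definition mo (A : {set {set T}}) : {set {set T}} := cl A :\: A.

End Closure.

(* Chains of all degrees over the full simplex on T, with coefficients in an  *)
(* abelian group G, in the single group chain.                                *)
Section Homology.
Variables (T : finType) (G : zmodType).

Local Open Scope ring_scope.

Definition chain := {ffun {set T} -> G}.

Definition chain_supp (c : chain) : {set {set T}} := [set s | c s != 0].

(* C_p(X), where X is a set of simplices; a p-simplex has p + 1 vertices.     *)
Definition chains (p : nat) (X : {set {set T}}) : {pred chain} :=
  fun c => chain_supp c \subset [set s in X | #|s| == p.+1].

(* The incidence sign of the facet t in v |: t is (-1)^i, where i is the      *)
(* position of v among the vertices of v |: t, listed in the order enum T.    *)
Definition incidence_odd (v : T) (t : {set T}) : bool :=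
  odd #|[set u in t | (enum_rank u < enum_rank v)%N]|.

(* The value at set0 is 0 because the homology is not augmented.              *)
Definition boundary (c : chain) : chain :=
  [ffun t : {set T} =>
     if t == set0 then 0
     else \sum_(v | v \notin t)
            (if incidence_odd v t then - c (v |: t) else c (v |: t))].

Lemma boundaryB : {morph boundary : c d / c - d}.
Proof.
move=> c d; apply/ffunP => t; rewrite !ffunE; case: eqP => _.
  by rewrite subrr.
rewrite -sumrB; apply: eq_bigr => v _; rewrite !ffunE.
by case: ifP => // _; rewrite opprB opprK addrC.
Qed.

Lemma boundary_boundary (c : chain) : boundary (boundary c) = 0.
Proof.
apply/ffunP => t; rewrite !ffunE; case: eqP => // /eqP tN0.
pose f (v w : T) : G :=
  if incidence_odd v t (+) incidence_odd w (v |: t)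
  then - c (w |: (v |: t)) else c (w |: (v |: t)).
have -> : \sum_(v | v \notin t) (if incidence_odd v t
      then - boundary c (v |: t) else boundary c (v |: t)) =
    \sum_(v | v \notin t) \sum_(w | w \notin v |: t) f v w.
  apply: eq_bigr => v _; rewrite ffunE.
  have -> : (v |: t == set0) = false.
    by apply/negbTE/set0Pn; exists v; rewrite setU11.
  rewrite /f; case: (incidence_odd v t) => //=.
  rewrite -sumrN; apply: eq_bigr => w _.
  by case: ifP => //= _; rewrite opprK.
have split_odd v w : w != v -> v \notin t ->
    incidence_odd w (v |: t) =
    incidence_odd w t (+) (enum_rank v < enum_rank w)%N.
  move=> _ vt; rewrite /incidence_odd.
  case vw: (enum_rank v < enum_rank w)%N.
    have -> : [set u in v |: t | (enum_rank u < enum_rank w)%N] =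
        v |: [set u in t | (enum_rank u < enum_rank w)%N].
      by apply/setP => u; rewrite !inE; case: eqP => [->|].
    by rewrite cardsU1 inE (negbTE vt) addbC /=.
  rewrite addbF; congr (odd _); apply: eq_card => u.
  by rewrite !inE; case: eqP => [->|//]; rewrite vw !andbF.
have rank_flip (v w : T) : w != v ->
    (enum_rank v < enum_rank w)%N = ~~ (enum_rank w < enum_rank v)%N.
  by case: ltngtP => // /val_inj/enum_rank_inj ->; rewrite eqxx.
have fN v w : w != v -> v \notin t -> w \notin t -> f v w = - f w v.
  move=> wv vt wt; rewrite /f !split_odd // 1?eq_sym //.
  rewrite setUCA.
  rewrite (rank_flip v w) //; case: (incidence_odd v t); case: (incidence_odd w t);
    case: (_ < _)%N => //=; by rewrite opprK.
pose P v w := [&& v \notin t, w \notin t & w != v].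
have -> : \sum_(v | v \notin t) \sum_(w | w \notin v |: t) f v w =
    \sum_(p : T * T | P p.1 p.2) f p.1 p.2.
  rewrite pair_big_dep /=; apply: eq_bigl => -[v w] /=.
  by rewrite /P !inE negb_or; case: (v \in t) => //=; rewrite andbC.
rewrite (bigID (fun p : T * T => (enum_rank p.1 < enum_rank p.2)%N)) /=.
rewrite [X in _ + X](reindex_inj (h := fun p : T * T => (p.2, p.1))) /=;
  last by move=> [a b] [a' b'] [-> ->].
rewrite -[X in _ + X]opprK -sumrN.
apply/eqP; rewrite subr_eq0; apply/eqP.
apply: eq_big => [[v w]|[v w]] /=; last first.
  by case/andP => /and3P[vt wt wv] _; rewrite fN.
rewrite /P eq_sym; case: (v \in t); case: (w \in t) => //=.
by case: eqVneq => //= vw; rewrite rank_flip 1?eq_sym.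
Qed.

Lemma chain_supp0 : chain_supp 0 = set0.
Proof. by apply/setP => s; rewrite /chain_supp !inE ffunE eqxx. Qed.

Lemma chain_suppB c d : chain_supp (c - d) \subset chain_supp c :|: chain_supp d.
Proof.
apply/subsetP => s; rewrite /chain_supp !inE !ffunE; apply: contraR.
by rewrite negb_or !negbK => /andP[/eqP -> /eqP ->]; rewrite subrr.
Qed.

Lemma boundary0 : boundary 0 = 0.
Proof. by have := boundaryB 0 0; rewrite !subrr. Qed.

Lemma chains_zmod_closed p X : zmod_closed (chains p X).
Proof.
split=> [|c d cX dX]; rewrite unfold_in; first by rewrite chain_supp0 sub0set.
by apply: subset_trans (chain_suppB c d) _; rewrite subUset; apply/andP.
Qed.

HB.instance Definition _ p X :=
  GRing.isZmodClosed.Build chain (chains p X) (chains_zmod_closed p X).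

Section RelativeHomology.
Variables (p : nat) (X A : {set {set T}}).

(* Z_p(X,A) is not taken modulo C_p(A); that happens in the final quotient,   *)
(* since B_p(X,A) contains C_p(A).                                            *)
Definition relcycles : {pred chain} :=
  fun c => (c \in chains p X) &&
           (chain_supp (boundary c) \subset A).

Definition relboundaries : {pred chain} :=
  fun c => `[< exists d a, [/\ d \in chains p.+1 X, a \in chains p A
                             & c = boundary d + a] >].

Lemma relcycles_zmod_closed : zmod_closed relcycles.
Proof.
split=> [|c d /andP[cX cA] /andP[dX dA]]; rewrite unfold_in.
  by rewrite rpred0 boundary0 chain_supp0 sub0set.
rewrite rpredB //= boundaryB; apply: subset_trans (chain_suppB _ _) _.
by rewrite subUset cA.
Qed.

HB.instance Definition _ :=
  GRing.isZmodClosed.Build chain relcycles relcycles_zmod_closed.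

Lemma relboundaries_zmod_closed : zmod_closed relboundaries.
Proof.
split=> [|c d /asboolP[c1 [a1 [c1X a1A ->]]] /asboolP[c2 [a2 [c2X a2A ->]]]].
  apply/asboolP; exists 0, 0; split; rewrite ?rpred0 //.
  by rewrite boundary0 addr0.
apply/asboolP; exists (c1 - c2), (a1 - a2); split; rewrite ?rpredB //.
by rewrite boundaryB opprD addrACA.
Qed.

HB.instance Definition _ :=
  GRing.isZmodClosed.Build chain relboundaries relboundaries_zmod_closed.

Record relcycle := RelCycle { relcycle_val :> chain; _ : relcycle_val \in relcycles }.

HB.instance Definition _ := [isSub for relcycle_val].
HB.instance Definition _ := [Choice of relcycle by <:].
HB.instance Definition _ := [SubChoice_isSubZmodule of relcycle by <:].

Definition bounding : {pred relcycle} := fun z => val z \in relboundaries.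

Lemma bounding_zmod_closed : zmod_closed bounding.
Proof.
split=> [|z w zB wB]; rewrite unfold_in.
  by rewrite raddf0 rpred0.
by rewrite raddfB rpredB.
Qed.

HB.instance Definition _ :=
  GRing.isZmodClosed.Build relcycle bounding bounding_zmod_closed.

(* H_p(X,A;G) = Z_p(X,A) / B_p(X,A)                                           *)
Definition homology : zmodType := Quotient.quot bounding.

End RelativeHomology.
End Homology.

Section Multivectors.
Variables (T : finType) (K : {set {set T}}).

Definition multivector (A : {set {set T}}) : Prop :=
  A \subset K /\
  forall s t s' : {set T}, s \in A -> s' \in A -> t \in K ->
    s \subset t -> t \subset s' -> t \in A.

Definition multivector_field (V : {set {set {set T}}}) : Prop :=
  partition V K /\ forall A, A \in V -> multivector A.

Definition mvf_meet (V1 V2 : {set {set {set T}}}) : {set {set {set T}}} :=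
  [set A :&: B | A in V1, B in V2 & A :&: B != set0].

Lemma mvf_meet_field (V1 V2 : {set {set {set T}}}) :
  multivector_field V1 -> multivector_field V2 ->
  multivector_field (mvf_meet V1 V2).
Proof.
move=> [/and3P[/eqP c1 t1 n1] m1] [/and3P[/eqP c2 t2 n2] m2].
split; last first.
  move=> C /imset2P[A B AV]; rewrite inE => /andP[BV _] ->.
  have [AK hA] := m1 _ AV; have [BK hB] := m2 _ BV.
  split; first by rewrite subIset // AK.
  move=> s t s' /setIP[sA sB] /setIP[s'A s'B] tK st ts'.
  by rewrite inE (hA s t s') // (hB s t s').
apply/and3P; split.
- apply/eqP/setP => s; apply/bigcupP/idP.
    case=> C /imset2P[A B AV]; rewrite inE => /andP[BV _] -> /setIP[sA _].
    exact: (subsetP (m1 _ AV).1).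
  move=> sK; exists (pblock V1 s :&: pblock V2 s); last first.
    by rewrite inE !mem_pblock c1 c2 sK.
  apply/imset2P; exists (pblock V1 s) (pblock V2 s) => //.
    by rewrite pblock_mem // c1.
  rewrite inE pblock_mem ?c2 //=; apply/set0Pn; exists s.
  by rewrite inE !mem_pblock c1 c2 sK.
- apply/trivIsetP => C D /imset2P[A B AV]; rewrite inE => /andP[BV _] ->.
  case/imset2P=> A' B' A'V; rewrite inE => /andP[B'V _] ->.
  apply: contraNT; rewrite -setI_eq0 => /set0Pn[s].
  case/setIP=> /setIP[sA sB] /setIP[sA' sB'].
  rewrite -(def_pblock t1 AV sA) -(def_pblock t2 BV sB).
  by rewrite -(def_pblock t1 A'V sA') -(def_pblock t2 B'V sB').
- apply/negP => /imset2P[A B AV]; rewrite inE => /andP[_ h] e.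
  by rewrite -e eqxx in h.
Qed.

Variable (G : zmodType).

Definition critical (A : {set {set T}}) : Prop :=
  exists p, exists h : homology G p (cl K A) (mo K A), h != 0%R.

Definition regular (A : {set {set T}}) : Prop := ~ critical A.

Section Dynamics.
Variable (V : {set {set {set T}}}).

(* For a multivector field V and s in K, pblock V s is the multivector [s]_V. *)
Definition F1 (s : {set T}) : {set {set T}} := cl K [set s] :|: pblock V s.

Definition Fmv (A : {set {set T}}) : {set {set T}} := \bigcup_(s in A) F1 s.

(* A path on Z \cap [a,b] is given by a map on int, of which only the values  *)
(* on [a,b] matter.                                                           *)
Definition is_path (a b : int) (rho : int -> {set T}) : Prop :=
  (forall i : int, (a <= i <= b)%R -> rho i \in K) /\
  (forall i : int, (a < i <= b)%R -> rho i \in F1 (rho (i - 1)%R)).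

Definition is_solution (rho : int -> {set T}) : Prop :=
  (forall i : int, rho i \in K) /\
  (forall i : int, rho i \in F1 (rho (i - 1)%R)).

Definition is_essential (rho : int -> {set T}) : Prop :=
  forall i : int, regular (pblock V (rho i)) ->
    (exists2 j : int, (j < i)%R & pblock V (rho j) <> pblock V (rho i)) /\
    (exists2 j : int, (i < j)%R & pblock V (rho j) <> pblock V (rho i)).

Definition Inv (A : {set {set T}}) : {set {set T}} :=
  [set s in A | `[< exists rho : int -> {set T},
      [/\ is_solution rho, is_essential rho,
          forall i : int, rho i \in A & rho 0%R = s] >]].

Definition invariant (A : {set {set T}}) : Prop := Inv A = A.

Definition isolated_invariant (N S : {set {set T}}) : Prop :=
  [/\ invariant S, closed_in K N, S \subset N
    & forall (a b : int) (rho : int -> {set T}),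
        (a <= b)%R -> is_path a b rho ->
        (forall i : int, (a <= i <= b)%R -> rho i \in N) ->
        rho a \in S -> rho b \in S ->
        forall i : int, (a <= i <= b)%R -> rho i \in S].

(* (P,E) is an index pair for S in N; that S is an invariant set isolated by  *)
(* N is part of the definition.                                               *)
Record index_pair (N S P E : {set {set T}}) : Prop := IndexPair {
  ip_isolated : isolated_invariant N S;
  ip_closedP : closed_in K P;
  ip_closedE : closed_in K E;
  ip_subEP : E \subset P;
  ip_subPN : P \subset N;
  ip_FP : Fmv P :&: N \subset P;
  ip_FE : Fmv E :&: N \subset E;
  ip_FPE : Fmv (P :\: E) \subset N;
  ip_Inv : S = Inv (P :\: E)
}.

End Dynamics.
End Multivectors.

(* Main.v *)
Require Import Defs.
From mathcomp Require Import all_boot all_order all_algebra.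
From mathcomp Require Import boolp zify.

(** The values of [F] for the meet of two fields lie in those of both fields,
    so the inclusions defining an index pair pass to intersections. A path in
    [N] with endpoints in [P \ E] stays in [P] and can never enter [E]; splicing
    it between essential solutions through its endpoints gives an essential
    solution in [P \ E], whence the isolation. Homology plays no role. *)

Set Implicit Arguments.
Unset Strict Implicit.
Unset Printing Implicit Defensive.

Section Dynamics.
Variables (T : finType) (G : zmodType) (K : {set {set T}}).
Implicit Types (V : {set {set {set T}}}) (A N P E : {set {set T}}).
Implicit Types (rho : int -> {set T}).

Lemma Inv_sub V A : Inv K G V A \subset A.
Proof. by apply/subsetP => s; rewrite inE => /andP[]. Qed.

(** Translating an essential solution in time gives an essential solution, so any of its values can
    be moved to time 0. *)
Lemma solution_Inv V A rho :
  is_solution K V rho -> is_essential K G V rho -> (forall i, rho i \in A) ->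
  forall i, rho i \in Inv K G V A.
Proof.
move=> [rK rF] ess rA i; rewrite inE rA; apply/asboolP.
exists (fun j => rho (j + i)%R); split; last by rewrite GRing.add0r.
- by split=> j //; rewrite GRing.addrAC.
- move=> j reg; have [[k1 lt1 ne1] [k2 lt2 ne2]] := ess (j + i)%R reg.
  split; [exists (k1 - i)%R | exists (k2 - i)%R]; rewrite ?GRing.subrK //; lia.
- by move=> j; apply: rA.
Qed.

(** An essential solution witnessing membership in [Inv K G V A] never leaves that set, by
    [solution_Inv], so it is also a witness for the iterated [Inv]. *)
Lemma invariant_Inv V A : Defs.invariant K G V (Inv K G V A).
Proof.
apply/eqP; rewrite eqEsubset Inv_sub; apply/subsetP => s.
rewrite [s \in Inv K G V A]inE => /andP[_ /asboolP[rho [sol ess rA <-]]].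
by apply: solution_Inv => // i; apply: solution_Inv.
Qed.

(** Induction on [j - i]: each step of the path lands in [Fmv K V P :&: N]. This serves both to stay
    in [P] and, applied to [E], to show that entering [E] is irreversible. *)
Lemma path_forward V N P rho (a b : int) :
  Fmv K V P :&: N \subset P -> is_path K V a b rho ->
  (forall i : int, (a <= i <= b)%R -> rho i \in N) ->
  forall i j : int, (a <= i)%R -> (i <= j <= b)%R -> rho i \in P -> rho j \in P.
Proof.
move=> /subsetP FP [_ pF] rN i j ai ijb riP.
have -> : j = (i + `|j - i|%N%:Z)%R by lia.
have : (i + `|j - i|%N%:Z <= b)%R by lia.
elim: `|j - i|%N => [|n IHn] le_b; first by rewrite GRing.addr0.
have IH : rho (i + n%:Z)%R \in P by apply: IHn; lia.
apply: FP; rewrite inE rN; last by lia.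
rewrite andbT; apply/bigcupP; exists (rho (i + n%:Z)%R) => //.
have -> : (i + n%:Z = i + n.+1%:Z - 1)%R by lia.
by apply: pF; lia.
Qed.

Lemma path_Inv V A rho (a b : int) : is_path K V a b rho ->
  (forall i : int, (a <= i <= b)%R -> rho i \in A) ->
  rho a \in Inv K G V A -> rho b \in Inv K G V A ->
  forall i : int, (a <= i <= b)%R -> rho i \in Inv K G V A.
Proof.
move=> [pK pF] rA; rewrite !inE => /andP[_ /asboolP[l [[lK lF] less lA l0]]].
case/andP=> _ /asboolP[u [[uK uF] uess uA u0]] i aib.
(* The past of [l] is shifted to end at time [a], the future of [u] to start at time [b]. *)
pose r j := if (j < a)%R then l (j - a)%R
            else if (j <= b)%R then rho j else u (j - b)%R.
(* Since [l] and [u] take the values [rho a] and [rho b] at time 0, each formula also holds at its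
   seam. Hence any two consecutive times fall under a single formula. *)
have rl j : (j <= a)%R -> r j = l (j - a)%R.
  rewrite /r => ja; case: ifP => // ja'; have -> : j = a by lia.
  by rewrite GRing.subrr l0 ifT //; lia.
have rr j : (a <= j <= b)%R -> r j = rho j.
  by move=> ajb; rewrite /r ifF ?ifT //; lia.
have ru j : (b <= j)%R -> r j = u (j - b)%R.
  rewrite /r => bj; rewrite ifF; last by lia.
  by case: ifP => // bj'; have -> : j = b by [lia]; rewrite GRing.subrr u0.
have cases j : [\/ (j <= a)%R, (a < j <= b)%R | (b < j)%R].
  case: (boolP (j <= a)%R) => [|ja]; first by constructor 1.
  by case: (boolP (j <= b)%R) => jb; [constructor 2 | constructor 3]; lia.
(* The earlier time at which [l] is in another multivector is again before [a], where [r] still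
   follows [l]. *)
have esc_l j : (j <= a)%R -> regular K G (pblock V (r j)) ->
    exists2 k : int, (k < j)%R & pblock V (r k) <> pblock V (r j).
  move=> ja; rewrite (rl _ ja) => /less [[k lt_k ne_k] _].
  by exists (k + a)%R; [lia | rewrite rl ?GRing.addrK //; lia].
have esc_u j : (b <= j)%R -> regular K G (pblock V (r j)) ->
    exists2 k : int, (j < k)%R & pblock V (r k) <> pblock V (r j).
  move=> bj; rewrite (ru _ bj) => /uess [_ [k lt_k ne_k]].
  by exists (k + b)%R; [lia | rewrite ru ?GRing.addrK //; lia].
rewrite -(rr i aib); apply: solution_Inv.
- split=> j; case: (cases j) => cj.
  + by rewrite rl.
  + by rewrite rr; [apply: pK|]; lia.
  + by rewrite ru //; lia.
  + rewrite !rl //; last by lia.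
    by have := lF (j - a)%R; rewrite GRing.addrAC.
  + by rewrite !rr; [apply: pF | |]; lia.
  + rewrite !ru; [|lia|lia].
    by have := uF (j - b)%R; rewrite GRing.addrAC.
- move=> j reg; split.
  + case: (boolP (j <= a)%R) => ja; first exact: esc_l.
    (* After [a], either [a] itself is a time in another multivector, or [r a] shares the regular
       multivector of [r j] and the past of [l] leaves it. *)
    case: (eqVneq (pblock V (r a)) (pblock V (r j))) => [e|/eqP ne].
      rewrite -e in reg *; have [//|k lt_k ne_k] := esc_l a _ reg.
      by exists k => //; lia.
    by exists a => //; lia.
  + case: (boolP (b <= j)%R) => bj; first exact: esc_u.
    case: (eqVneq (pblock V (r b)) (pblock V (r j))) => [e|/eqP ne].
      rewrite -e in reg *; have [//|k lt_k ne_k] := esc_u b _ reg.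
      by exists k => //; lia.
    by exists b => //; lia.
- move=> j; case: (cases j) => cj.
  + by rewrite rl.
  + by rewrite rr; [apply: rA|]; lia.
  + by rewrite ru //; lia.
Qed.

(** A path starting in [P] remains there, and one that met [E] would still be in [E] at time [b],
    where [rho b] is outside [E]. So it runs in [P :\: E], and [path_Inv] applies. *)
Lemma isolated_invariant_Inv V N P E : closed_in K N -> P \subset N ->
  Fmv K V P :&: N \subset P -> Fmv K V E :&: N \subset E ->
  isolated_invariant K G V N (Inv K G V (P :\: E)).
Proof.
move=> hN PN FP FE; split=> //; first exact: invariant_Inv.
  by rewrite (subset_trans (Inv_sub _ _)) // (subset_trans (subsetDl _ _)).
move=> a b rho ab hrho rN Sa Sb; apply: path_Inv => // i aib.
have := subsetP (Inv_sub _ _) _ Sa; have := subsetP (Inv_sub _ _) _ Sb.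
rewrite !inE => /andP[rbE _] /andP[_ raP]; apply/andP; split.
  by apply: contra rbE; apply: (path_forward FE hrho rN); lia.
by apply: (path_forward FP hrho rN) raP; lia.
Qed.

Lemma closed_inI A B : closed_in K A -> closed_in K B -> closed_in K (A :&: B).
Proof.
move=> cA cB; have AK : A \subset K.
  by rewrite -cA; apply/subsetP => s; rewrite inE => /andP[].
apply/setP => s; apply/idP/idP.
  rewrite !inE => /andP[sK /existsP[t /andP[/setIP[tA tB] st]]].
  rewrite -cA -cB !inE sK /=; apply/andP.
  by split; apply/existsP; exists t; rewrite ?tA ?tB.
move=> sAB; rewrite inE; apply/andP; split.
  by case/setIP: sAB => /(subsetP AK).
by apply/existsP; exists s; rewrite sAB subxx.
Qed.

Lemma pblock_mvf_meet V1 V2 (s : {set T}) :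
  multivector_field K V1 -> multivector_field K V2 ->
  pblock (mvf_meet V1 V2) s \subset pblock V1 s :&: pblock V2 s.
Proof.
move=> hV1 hV2; case: (boolP (s \in cover (mvf_meet V1 V2))) => sV; last first.
  (* Outside the cover, [pblock] takes its default value [set0]. *)
  by rewrite /pblock; case: pickP => [C /andP[CV sC]|_]; rewrite ?sub0set //;
    case/bigcupP: sV; exists C.
have sC := sV; rewrite -mem_pblock in sC.
case/imset2P: (pblock_mem sV) sC => A B AV; rewrite inE => /andP[BV _] ->.
case/setIP=> sA sB; case: hV1 hV2 => [/and3P[_ t1 _] _] [/and3P[_ t2 _] _].
by rewrite (def_pblock t1 AV sA) (def_pblock t2 BV sB).
Qed.

(** The closure term is common to all three fields, and union distributes over intersection. *)
Lemma F1_mvf_meet V1 V2 (s : {set T}) :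
  multivector_field K V1 -> multivector_field K V2 ->
  F1 K (mvf_meet V1 V2) s \subset F1 K V1 s :&: F1 K V2 s.
Proof.
move=> hV1 hV2; rewrite /F1 -setUIr.
exact: setUS (pblock_mvf_meet _ hV1 hV2).
Qed.

Lemma Fmv_mvf_meetI V1 V2 N A B :
  multivector_field K V1 -> multivector_field K V2 ->
  Fmv K V1 A :&: N \subset A -> Fmv K V2 B :&: N \subset B ->
  Fmv K (mvf_meet V1 V2) (A :&: B) :&: N \subset A :&: B.
Proof.
move=> hV1 hV2 /subsetP FA /subsetP FB; apply/subsetP => t /setIP[].
case/bigcupP=> s /setIP[sA sB] /(subsetP (F1_mvf_meet _ hV1 hV2)) /setIP[t1 t2] tN.
by rewrite inE FA ?FB // inE tN andbT; apply/bigcupP; exists s.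
Qed.

End Dynamics.

Theorem theorem10 (T : finType) (G : zmodType) (K N : {set {set T}})
    (V1 V2 : {set {set {set T}}}) (S1 S2 P1 P2 E1 E2 : {set {set T}})
    (hK : simplicial_complex K) (hNK : N \subset K) (hN : closed_in K N)
    (hV1 : multivector_field K V1) (hV2 : multivector_field K V2)
    (h1 : index_pair K G V1 N S1 P1 E1) (h2 : index_pair K G V2 N S2 P2 E2) :
  index_pair K G (mvf_meet V1 V2) N
    (Inv K G (mvf_meet V1 V2) ((P1 :&: P2) :\: (E1 :&: E2)))
    (P1 :&: P2) (E1 :&: E2).
Proof.
case: h1 => _ cP1 cE1 EP1 PN1 FP1 FE1 FPE1 _.
case: h2 => _ cP2 cE2 EP2 PN2 FP2 FE2 FPE2 _.
have FP := Fmv_mvf_meetI hV1 hV2 FP1 FP2.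
have FE := Fmv_mvf_meetI hV1 hV2 FE1 FE2.
have PN : P1 :&: P2 \subset N by rewrite subIset ?PN1.
split=> //; try exact: closed_inI; first exact: isolated_invariant_Inv.
  exact: setISS.
apply/subsetP => t /bigcupP[s /setDP[/setIP[sP1 sP2] sE]].
move=> /(subsetP (F1_mvf_meet _ hV1 hV2)) /setIP[t1 t2].
(* A simplex outside [E1 :&: E2] avoids one of the two sets, and the exit condition of that index
   pair alone puts [t] in [N]. *)
move: sE; rewrite inE negb_and => /orP[sE|sE].
  by apply: (subsetP FPE1); apply/bigcupP; exists s; rewrite // inE sE.
by apply: (subsetP FPE2); apply/bigcupP; exists s; rewrite // inE sE.
Qed.
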